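(* Let $R$ be a $*$-ring. Then the following statements (1)–(4) are equivalent: (1) $R$ is strongly $\pi$-$*$-regular. (2) $R$ is $\pi$-regular and $R$ satisfies one of the following conditions (a)–(d), these four conditions being equivalent to one another: (a) for each idempotent $e^2=e\in R$ one has $e-e^*\in J(R)$, and $R$ is $*$-abelian; (b) for each idempotent $e^2=e\in R$ one has $e-e^*\in Nil(R)$, and $R$ is $*$-abelian; (c) for each idempotent $e^2=e\in R$ one has $e-e^*\in J(R)$ and $ee^*=e^*e$; (d) for each idempotent $e^2=e\in R$ one has $e-e^*\in Nil(R)$ and $ee^*=e^*e$. (3) $R$ is $*$-abelian and, for each $a\in R$, there is an integer $m\geq 1$ such that $Ra^m=Ra^m(a^m)^*a^m$. (4) For each $a\in R$, there exist an idempotent $e^2=e\in R$ and an integer $n\geq 1$ such that $Ra^n=R(a^n)^*=Re$.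
   Context: All rings are associative with identity $1\neq 0$ (not necessarily commutative). An involution on a ring $R$ is a map $*:R\to R$ with $(x+y)^*=x^*+y^*$, $(xy)^*=y^*x^*$ and $(x^* )^*=x$ for all $x,y\in R$; a $*$-ring is a ring equipped with an involution. A projection of a $*$-ring is an element $p$ with $p^2=p=p^*$. A $*$-ring is $*$-abelian if all of its projections are central. $J(R)$ denotes the Jacobson radical of $R$, $Nil(R)$ the set of nilpotent elements of $R$, and $U(R)$ the group of units of $R$. For $x\in R$, $Rx=\{rx: r\in R\}$ is the principal left ideal generated by $x$. A ring $R$ is $\pi$-regular if for every $a\in R$ there is an integer $n\geq 1$ with $a^n\in a^nRa^n$. A $*$-ring $R$ is strongly $\pi$-$*$-regular if for every $a\in R$ there exist an integer $n\geq 1$, a projection $p\in R$ and a unit $u\in U(R)$ such that $a^n=pu$ and $a,p,u$ commute with each other. *)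

(* Defs.v *)
From HB Require Import structures.
From mathcomp Require Import all_boot ssralg ring_quotient.
From mathcomp Require Import boolp classical_sets.

Set Implicit Arguments.
Unset Strict Implicit.
Unset Printing Implicit Defensive.

Import GRing.Theory.
Local Open Scope ring_scope.
Local Open Scope classical_set_scope.

HB.mixin Record NzRing_isStarRing R of GRing.NzRing R := {
  star : R -> R;
  starD : {morph star : x y / x + y};
  starM : forall x y, star (x * y) = star y * star x;
  starK : involutive star
}.

#[short(type="starRingType")]
HB.structure Definition StarRing :=
  { R of NzRing_isStarRing R & GRing.NzRing R }.

Section Rings.
Variable R : nzRingType.
Implicit Types a x e : R.

Definition idempotent_elt e := e ^+ 2 = e.

Definition central x := forall r : R, GRing.comm x r.

(* Two-sided invertibility, as a proposition: [GRing.unit] would require the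
   decidability of invertibility that is built into [unitRingType]. *)
Definition invertible (u : R) := exists v : R, v * u = 1 /\ u * v = 1.

Definition principal_left_ideal x : set R := [set r * x | r in [set: R]].

(* [idealr_closed] describes the proper additive subgroups that are stable
   under multiplication on the left by any ring element, i.e., the proper left
   ideals, although the library calls them right ideals. *)
Definition maximal_left_ideal (M : set R) :=
  idealr_closed (mem M) /\
  forall I : set R, idealr_closed (mem I) -> M `<=` I -> I = M.

Definition jacobson_radical : set R :=
  [set x | forall M : set R, maximal_left_ideal M -> M x].

Definition nil_set : set R := [set x | exists n : nat, x ^+ n = 0].

Definition pi_regular :=
  forall a, exists2 n : nat, (1 <= n)%N & exists r, a ^+ n = a ^+ n * r * a ^+ n.

End Rings.

Arguments jacobson_radical : clear implicits.
Arguments nil_set : clear implicits.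

Section StarRings.
Variable R : starRingType.
Implicit Types a p u e : R.

Definition projection p := p ^+ 2 = p /\ p = star p.

Definition star_abelian := forall p, projection p -> central p.

Definition strongly_pi_star_regular :=
  forall a, exists (n : nat) p u,
    [/\ (1 <= n)%N, projection p, invertible u, a ^+ n = p * u &
        [/\ GRing.comm a p, GRing.comm a u & GRing.comm p u]].

Definition rad_star_abelian :=
  (forall e, idempotent_elt e -> e - star e \in jacobson_radical R) /\
  star_abelian.

Definition nil_star_abelian :=
  (forall e, idempotent_elt e -> e - star e \in nil_set R) /\ star_abelian.

Definition rad_star_normal :=
  forall e, idempotent_elt e ->
    e - star e \in jacobson_radical R /\ e * star e = star e * e.

Definition nil_star_normal :=
  forall e, idempotent_elt e ->
    e - star e \in nil_set R /\ e * star e = star e * e.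

End StarRings.

(* Main.v *)
(* The pivot is the property that every idempotent is a projection.  It makes
   idempotents central, because [e + e r (1 - e)] is again self-adjoint, and it
   is equivalent to each of (a)-(d).  For (a) and (b), [w = 1 - (e - e^* )^2] is
   invertible and commutes with [e] and [e^*], so that [e e^* w^-1] is a
   projection generating [eR] (Kaplansky); as it is central, it equals [e].  For
   (c) and (d), a difference [x] of commuting idempotents satisfies [x^3 = x].
   If idempotents are projections and [b = b r b], then [r b = b r] is a central
   projection and [b] is invertible in the corner it cuts out; applied to a power
   [b] of a given element, this yields (1)-(4). *)
Require Import Defs.
From HB Require Import structures.
From mathcomp Require Import all_boot ssralg ring_quotient.
From mathcomp Require Import boolp classical_sets.

Set Implicit Arguments.
Unset Strict Implicit.
Unset Printing Implicit Defensive.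

Import GRing.Theory.
Local Open Scope ring_scope.
Local Open Scope classical_set_scope.

(** * Maximal left ideals, the radical, and units of the form [1 - x] *)

Lemma left_ideal_in_maximal (R : nzRingType) (I : set R) :
  idealr_closed (mem I) ->
  exists M : set R, maximal_left_ideal M /\ I `<=` M.
Proof.
move=> [I0 I1 Ilin].
(* The empty chain forces [set0] to satisfy the property given to Zorn. *)
have [|A [[A0 A1 Alin] Amax]] :=
  @Zorn_bigcup R (fun X => idealr_closed (mem (X `|` I))).
  move=> F FP Ftot; split.
  - by apply/mem_set; right; apply/set_mem.
  - apply/negP => /set_mem [[X FX X1]|/mem_set I1'].
      by case: (FP X FX) => _ /negP nX1 _; apply: nX1; apply/mem_set; left.
    by move/negP: I1; apply.
  - move=> a u v uF vF; apply/mem_set.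
    have inU X w : F X -> w \in X `|` I -> ((\bigcup_(Y in F) Y) `|` I) w.
      by move=> FX /set_mem [Xw|Iw]; [left; exists X|right].
    have linX X : F X -> u \in X `|` I -> v \in X `|` I ->
        ((\bigcup_(Y in F) Y) `|` I) (a * u + v).
      by move=> FX uX vX; apply: (inU X) => //; case: (FP X FX) => _ _; apply.
    case/set_mem: uF => [[X FX Xu]|Iu]; case/set_mem: vF => [[Y FY Yv]|Iv].
    + case: (Ftot X Y FX FY) => [XY|YX].
        by apply: (linX Y) => //; apply/mem_set; left => //; exact: XY.
      by apply: (linX X) => //; apply/mem_set; left => //; exact: YX.
    + by apply: (linX X) => //; apply/mem_set; [left|right].
    + by apply: (linX Y) => //; apply/mem_set; [right|left].
    + by right; apply/set_mem; apply: Ilin; apply/mem_set.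
exists (A `|` I); split; last by move=> x Ix; right.
split=> [|K Kideal AIK]; first by split.
(* A proper left ideal containing [A] and [I] absorbs [I], so it is itself a candidate in Zorn's
   lemma. *)
have KI : K `|` I = K.
  by apply/seteqP; split => x; [case=> // Ix; apply: AIK; right|left].
apply/seteqP; split=> [x Kx|//]; apply: contrapT => nAIx.
apply: (Amax K); last by rewrite KI.
split=> [y Ay|KA]; first by apply: AIK; left.
by apply: nAIx; left; apply: KA.
Qed.

Lemma jacobson_radicalM (R : nzRingType) (a x : R) :
  jacobson_radical R x -> jacobson_radical R (a * x).
Proof.
move=> Jx M maxM; have [[M0 _ Mlin] _] := maxM.
rewrite -[a * x]addr0; apply/set_mem/Mlin => //; exact: mem_set (Jx M maxM).
Qed.

Lemma jacobson_radical0 (R : nzRingType) : jacobson_radical R 0.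
Proof. by move=> M [[M0 _ _] _]; exact: set_mem. Qed.

(** Otherwise [1 - x] generates a proper left ideal; a maximal left ideal above it also contains
    [x], hence contains 1. *)
Lemma jacobson_left_inverse (R : nzRingType) (x : R) :
  jacobson_radical R x -> exists v, v * (1 - x) = 1.
Proof.
move=> Jx; apply: contrapT => nv.
have [|M [maxM IM]] := @left_ideal_in_maximal R (principal_left_ideal (1 - x)).
  split.
  - by apply/mem_set; exists 0 => //; rewrite mul0r.
  - by apply/negP => /set_mem [v _ vx]; apply: nv; exists v.
  - move=> a u v /set_mem [r _ <-] /set_mem [s _ <-]; apply/mem_set.
    by exists (a * r + s) => //; rewrite mulrDl mulrA.
have [[_ /negP M1 Mlin] _] := maxM; apply: M1.
have -> : 1 = 1 * (1 - x) + x by rewrite mul1r subrK.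
apply: Mlin; apply/mem_set; last exact: (Jx M).
by apply: IM; exists 1; rewrite ?mul1r.
Qed.

(** A left inverse [v] of [1 - x] equals [1 + v * x], so it has the same shape and has a left
    inverse too. Having inverses on both sides, [v] is a unit, with inverse [1 - x]. *)
Lemma jacobson_unit (R : nzRingType) (x : R) :
  jacobson_radical R x -> invertible (1 - x).
Proof.
move=> Jx; have [v vx] := jacobson_left_inverse Jx.
have vE : v = 1 - (- v) * x.
  by rewrite mulNr opprK -[LHS](subrK (v * x)) -{1}[v]mulr1 -mulrBr vx.
have [u] := jacobson_left_inverse (jacobson_radicalM (- v) Jx).
rewrite -vE => uv; exists v; split=> //.
have <- : u = 1 - x by rewrite -[LHS]mulr1 -{1}vx mulrA uv mul1r.
exact: uv.
Qed.

Lemma nilpotent_unit (R : nzRingType) (x : R) :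
  nil_set R x -> invertible (1 - x).
Proof.
case=> n xn; exists (\sum_(i < n) x ^+ i).
have xE : 1 = (1 - x) * (\sum_(i < n) x ^+ i).
  by rewrite -opprB mulNr -subrX1 xn sub0r opprK.
split; last by rewrite -xE.
rewrite [RHS]xE -/(GRing.comm _ _); apply: commr_sym.
by apply: commr_sum => i _; apply/commrX/commr_sym/commrB/commr_refl/commr1.
Qed.

Lemma cube_eq_unit (R : nzRingType) (x : R) :
  x ^+ 3 = x -> invertible (1 - x ^+ 2) -> x = 0.
Proof.
move=> x3 [v [_ wv]].
by rewrite -[x]mulr1 -wv mulrA mulrBr mulr1 -exprS x3 subrr mul0r.
Qed.

(** * Self-adjoint idempotents are central *)

Section StarIdempotents.
Variable R : starRingType.
Implicit Types a b e r : R.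

Lemma star0 : star 0 = 0 :> R.
Proof. by apply: (addrI (star 0)); rewrite -starD !addr0. Qed.

Lemma starN a : star (- a) = - star a.
Proof. by apply: (addrI (star a)); rewrite -starD !subrr star0. Qed.

Lemma starB a b : star (a - b) = star a - star b.
Proof. by rewrite starD starN. Qed.

Lemma star1 : star 1 = 1 :> R.
Proof. by rewrite -[LHS]mul1r -{1}[1](@starK R) -starM mul1r starK. Qed.

Definition idempotents_self_adjoint := forall e, idempotent_elt e -> star e = e.

Lemma self_adjoint_projection :
  idempotents_self_adjoint -> forall e, idempotent_elt e -> projection e.
Proof. by move=> sa e ee; split; rewrite ?sa. Qed.

Lemma self_adjoint_central :
  idempotents_self_adjoint -> forall e, idempotent_elt e -> central e.
Proof.
move=> sa e /[dup] ee; rewrite /idempotent_elt expr2 => eE.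
(* Here [t = e r (1 - e)] satisfies [e t = t] and [t e = 0], so [e + t] is idempotent. Its
   self-adjointness gives [star t = t], and then [t = e t = star (t e) = 0]. *)
have se := sa e ee.
have erE r : e * r = e * r * e.
  pose t := e * r - e * r * e.
  have et : e * t = t by rewrite /t mulrBr !mulrA eE.
  have te : t * e = 0 by rewrite /t mulrBl -!mulrA eE subrr.
  apply/eqP; rewrite -subr_eq0 -/t; move: t et te => t et te.
  have tt : t * t = 0 by rewrite -{2}et mulrA te mul0r.
  have : star (e + t) = e + t.
    by apply: sa; rewrite /idempotent_elt expr2 mulrDl !mulrDr eE et te tt !addr0.
  by rewrite starD se => /addrI st; rewrite -et -st -{1}se -starM te star0.
(* Applying [star] to the identity for [star r] gives the mirror identity [r e = e r e]. *)
move=> r; have := congr1 star (erE (star r)).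
by rewrite !starM starK se mulrA -erE.
Qed.

Lemma self_adjoint_star_abelian : idempotents_self_adjoint -> star_abelian R.
Proof. by move=> sa p [pp _]; exact: self_adjoint_central. Qed.

(** * Conditions (a)-(d) and self-adjointness of idempotents *)

Lemma star_idempotent e : idempotent_elt e -> star e * star e = star e.
Proof. by rewrite -starM -expr2 => ->. Qed.

(** The invertibility hypothesis is what (a) and (b) have in common: it follows from [e - star e]
    being in the radical as well as from its being nilpotent. *)
Lemma star_abelian_self_adjoint e :
  star_abelian R -> idempotent_elt e ->
  invertible (1 - (e - star e) ^+ 2) -> star e = e.
Proof.
move=> ab ee; have sse := star_idempotent ee.
move: ee; rewrite /idempotent_elt expr2 => ee.
set w := 1 - _; case=> v [vw wv]; pose f := star e.
have wE : w = 1 - e + e * f + f * e - f.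
  by rewrite /w expr2 mulrBl !mulrBr ee sse !opprB !addrA [LHS](ACl (1*5*4*2*3)).
(* Multiplication by [e] on either side reduces [w] to [e * f * e]. So [w] commutes with [e], and
   with [f] by applying [star]; its inverse [v] inherits both. *)
have ew : e * w = e * f * e.
  by rewrite wE !(mulrDr, mulrN) mulr1 !mulrA ee subrr add0r addrAC subrr add0r.
have we : w * e = e * f * e.
  by rewrite wE !(mulrDl, mulNr) mul1r -!mulrA ee subrr add0r -addrA subrr addr0
     mulrA.
have sw : star w = w.
  by rewrite wE !(starB, starD) star1 !starM /f !starK [LHS](ACl (1*5*3*4*2)).
have fw : f * w = w * f.
  by have := congr1 star (etrans ew (esym we)); rewrite !starM sw.
have vcomm a : a * w = w * a -> a * v = v * a.
  by move=> aw; rewrite -[LHS]mul1r -vw !mulrA -(mulrA v) -aw -!mulrA wv mulr1.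
have ev : e * v = v * e by apply: vcomm; rewrite ew we.
have fv : f * v = v * f by exact: vcomm.
have sv : star v = v.
  have svw : star v * w = 1 by rewrite -[w]sw -starM wv star1.
  by rewrite -[LHS]mulr1 -wv mulrA svw mul1r.
(* As [e * f * e = e * w], the factor [v] is what turns [p * e] into [e]. *)
pose p := e * f * v.
have pe : p * e = e by rewrite /p -mulrA -ev mulrA -ew -mulrA wv mulr1.
have ep : e * p = p by rewrite /p !mulrA ee.
have sp : star p = p by rewrite /p !starM sv starK -/f mulrA -ev -[LHS]mulrA -fv mulrA.
have pp : projection p.
  by split; [rewrite expr2 {2}/p !mulrA pe | rewrite sp].
have pE : p = e by rewrite -ep -(ab p pp e).
by rewrite -pE.
Qed.

(** Heuristically, commuting idempotents have joint eigenvalues 0 and 1, so their difference has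
    eigenvalues 0, 1 and -1, the roots of [X^3 - X]. *)
Lemma cubeB_star e :
  idempotent_elt e -> e * star e = star e * e ->
  (e - star e) ^+ 3 = e - star e.
Proof.
move=> ee; have ss := star_idempotent ee.
move: ee; rewrite /idempotent_elt expr2; move: (star e) ss => f ff ee ef.
have fef : f * (e * f) = e * f by rewrite ef mulrA ff.
have x2 : (e - f) ^+ 2 = e + f - e * f *+ 2.
  rewrite expr2 mulrBl !mulrBr ee ff -ef opprB mulr2n opprD !addrA.
  by rewrite [LHS](ACl (1*3*2*4)).
rewrite exprS x2 mulrBl !mulrBr !mulrnAr fef mulrA ee !mulrDr ee ff -ef.
by rewrite opprB addrA subrK opprD addrA addrK.
Qed.

Lemma commuting_self_adjoint e :
  idempotent_elt e -> e * star e = star e * e ->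
  invertible (1 - (e - star e) ^+ 2) -> star e = e.
Proof.
by move=> ee ef /(cube_eq_unit (cubeB_star ee ef))/eqP; rewrite subr_eq0 => /eqP.
Qed.

Lemma nil_setX2 a : nil_set R a -> nil_set R (a ^+ 2).
Proof. by case=> n an; exists n; rewrite exprAC an expr0n. Qed.

Lemma rad_star_abelian_self_adjoint :
  rad_star_abelian R <-> idempotents_self_adjoint.
Proof.
split=> [[rad ab] e ee|sa].
  apply: star_abelian_self_adjoint => //.
  rewrite expr2; exact: jacobson_unit (jacobson_radicalM _ (set_mem (rad e ee))).
split; last exact: self_adjoint_star_abelian.
by move=> e ee; rewrite sa // subrr; exact: mem_set (@jacobson_radical0 R).
Qed.

Lemma nil_star_abelian_self_adjoint :
  nil_star_abelian R <-> idempotents_self_adjoint.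
Proof.
split=> [[nil ab] e ee|sa].
  apply: star_abelian_self_adjoint => //.
  exact: nilpotent_unit (nil_setX2 (set_mem (nil e ee))).
split; last exact: self_adjoint_star_abelian.
by move=> e ee; rewrite sa // subrr; apply/mem_set; exists 1%N.
Qed.

Lemma rad_star_normal_self_adjoint :
  rad_star_normal R <-> idempotents_self_adjoint.
Proof.
split=> [rad e ee|sa e ee].
  have [xrad ef] := rad e ee.
  apply: commuting_self_adjoint => //.
  rewrite expr2; exact: jacobson_unit (jacobson_radicalM _ (set_mem xrad)).
by rewrite sa // subrr; split=> //; exact: mem_set (@jacobson_radical0 R).
Qed.

Lemma nil_star_normal_self_adjoint :
  nil_star_normal R <-> idempotents_self_adjoint.
Proof.
split=> [nil e ee|sa e ee].
  have [xnil ef] := nil e ee.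
  apply: commuting_self_adjoint => //.
  exact: nilpotent_unit (nil_setX2 (set_mem xnil)).
by rewrite sa // subrr; split=> //; apply/mem_set; exists 1%N.
Qed.

(** * Regular elements and principal left ideals *)

Lemma regular_corner b r :
  idempotents_self_adjoint -> b = b * r * b ->
  exists e, [/\ projection e, central e, r * b = e, b * r = e & b * e = b].
Proof.
move=> sa bE.
have rbI : idempotent_elt (r * b) by rewrite /idempotent_elt expr2 -mulrA (mulrA b) -bE.
have brI : idempotent_elt (b * r) by rewrite /idempotent_elt expr2 !mulrA -bE.
have rbC := self_adjoint_central sa rbI.
have brC := self_adjoint_central sa brI.
(* Centrality of [r b], then of [b r], gives [b (r b) r = (r b) (b r) = (b r) (r b) = r (b r) b = r
   b]. *)
have brE : b * r = r * b.
  have -> : b * r = b * (r * b) * r by rewrite mulrA -bE.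
  by rewrite -(rbC b) -mulrA (rbC (b * r)) mulrA (brC r) -mulrA -bE.
by exists (r * b); split; rewrite // ?mulrA //; exact: self_adjoint_projection.
Qed.

Lemma principal_left_ideal_eq a b :
  (exists r, b = r * a) -> (exists r, a = r * b) ->
  principal_left_ideal a = principal_left_ideal b.
Proof.
move=> [r bE] [s aE]; apply/seteqP; split=> _ [t _ <-].
  by exists (t * s) => //; rewrite -mulrA -aE.
by exists (t * r) => //; rewrite -mulrA -bE.
Qed.

Lemma principal_left_ideal_eqP a b :
  principal_left_ideal a = principal_left_ideal b -> exists r, a = r * b.
Proof.
move=> ab; have : principal_left_ideal b a.
  by rewrite -ab; exists 1 => //; rewrite mul1r.
by case=> r _ <-; exists r.
Qed.

(** This allows conditions on some positive power of each element to be tested on idempotents. *)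
Lemma idempotentX n e : (1 <= n)%N -> idempotent_elt e -> e ^+ n = e.
Proof.
case: n => // n _ ee; elim: n => [|n IHn]; first by rewrite expr1.
by rewrite exprS IHn -expr2.
Qed.

(** * The implications between (1), (2), (3) and (4) *)

(** If [e = p u], then [p e = e], while [e e = e] reads [e p u = p u] and yields [e p = p] on
    cancelling [u]. As [e] and [p] commute, they are equal. *)
Lemma strongly_pi_star_regular_self_adjoint :
  strongly_pi_star_regular R -> idempotents_self_adjoint.
Proof.
move=> str e ee.
have [n [p [u [n1 [pp sp] [v [vu uv]] eE [ep _ pu]]]]] := str e.
rewrite idempotentX // in eE.
have pe : p * e = e by rewrite eE mulrA -expr2 pp.
have e_p : e * p = p.
  have eep : e * p * u = p * u by rewrite -mulrA -eE -expr2.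
  by rewrite -[LHS]mulr1 -uv mulrA eep -mulrA uv mulr1.
have pE : p = e by rewrite -[LHS]e_p ep.
by rewrite -pE -sp.
Qed.

Lemma strongly_pi_star_regular_pi_regular :
  strongly_pi_star_regular R -> pi_regular R.
Proof.
move=> str a; have [n [p [u [n1 [pp _] [v [_ uv]] aE _]]]] := str a.
by exists n => //; exists v; rewrite aE -(mulrA p u v) uv mulr1 mulrA -expr2 pp.
Qed.

Lemma pi_regular_star_cube :
  idempotents_self_adjoint -> pi_regular R ->
  forall a, exists2 m : nat, (1 <= m)%N &
    principal_left_ideal (a ^+ m) =
    principal_left_ideal (a ^+ m * star (a ^+ m) * a ^+ m).
Proof.
move=> sa reg a; have [m m1 [r aE]] := reg a; exists m => //.
have [e [[ee se] ce rb br be]] := regular_corner sa aE.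
move: (a ^+ m) rb br be => b rb br be {aE}.
apply: principal_left_ideal_eq; first by exists (b * star b).
(* The factor [r] cancels the leftmost [b] to [e], which is central; then
   [star r * star b = star (b * r) = e]. *)
exists (star r * r); rewrite !mulrA -(mulrA (star r)) rb -(mulrA _ e) (ce (star b)).
by rewrite !mulrA -starM br -se -expr2 ee ce be.
Qed.

(** Write [b = y b (star b) b] and [e = y b (star b)]. Then [e] fixes [b], hence also [star e],
    which is a right multiple of [b]. So [star e = e (star e)] is self-adjoint. *)
Lemma star_cube_regular b :
  principal_left_ideal b = principal_left_ideal (b * star b * b) ->
  exists e c, [/\ projection e, e * b = b & e = b * c].
Proof.
move=> /principal_left_ideal_eqP [y bE].
pose e := y * b * star b.
have eb : e * b = b by rewrite [RHS]bE /e !mulrA.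
have ese : star e = b * (star b * star y) by rewrite /e !starM starK.
have ebs : e * star e = star e by rewrite ese mulrA eb.
have se : star e = e by have := congr1 star ebs; rewrite starM starK ebs.
exists e, (star b * star y); split=> //; last by rewrite -ese.
by split=> //; rewrite expr2 -{2}se ebs.
Qed.

Lemma star_cube_self_adjoint :
  star_abelian R ->
  (forall a : R, exists2 m : nat, (1 <= m)%N &
    principal_left_ideal (a ^+ m) =
    principal_left_ideal (a ^+ m * star (a ^+ m) * a ^+ m)) ->
  idempotents_self_adjoint.
Proof.
move=> ab H e ee; have [m m1] := H e.
rewrite idempotentX // => /star_cube_regular [p [c [pp pe pE]]].
(* From [p = e * c] follows [e * p = p], whereas [p * e = e]; centrality of [p] identifies the
   two. *)
have pe_eq : p = e by rewrite -pe (ab p pp e) pE mulrA -expr2 ee.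
by case: pp; rewrite pe_eq => _ <-.
Qed.

Lemma star_cube_principal :
  star_abelian R ->
  (forall a : R, exists2 m : nat, (1 <= m)%N &
    principal_left_ideal (a ^+ m) =
    principal_left_ideal (a ^+ m * star (a ^+ m) * a ^+ m)) ->
  forall a, exists (e : R) (n : nat),
    [/\ idempotent_elt e, (1 <= n)%N,
        principal_left_ideal (a ^+ n) = principal_left_ideal (star (a ^+ n)) &
        principal_left_ideal (star (a ^+ n)) = principal_left_ideal e].
Proof.
move=> ab H a; have sa := star_cube_self_adjoint ab H.
have [m m1 /star_cube_regular [p [c [_ pb pE]]]] := H a.
(* The projection [p = a ^+ m * c] fixes [a ^+ m], so [c] is a von Neumann inverse of [a ^+ m]. *)
have [|e [[ee se] ce cb bc be]] := @regular_corner (a ^+ m) c sa.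
  by rewrite -pE.
have bsE : principal_left_ideal (star (a ^+ m)) = principal_left_ideal e.
  apply: principal_left_ideal_eq.
    by exists (star c); rewrite -starM bc.
  by exists (star (a ^+ m)); rewrite [in RHS]se -starM ce be.
exists e, m; split=> //; rewrite bsE; apply: principal_left_ideal_eq.
  by exists c.
by exists (a ^+ m).
Qed.

Lemma principal_strongly_pi_star_regular :
  (forall a : R, exists (e : R) (n : nat),
    [/\ idempotent_elt e, (1 <= n)%N,
        principal_left_ideal (a ^+ n) = principal_left_ideal (star (a ^+ n)) &
        principal_left_ideal (star (a ^+ n)) = principal_left_ideal e]) ->
  strongly_pi_star_regular R.
Proof.
move=> H.
(* For an idempotent [g] the hypothesis gives [g = s (star g)], so [g (star g) = g], whose left side
   is self-adjoint. *)
have sa : idempotents_self_adjoint.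
  move=> g gg; have [e [n [_ n1 + _]]] := H g.
  rewrite idempotentX // => /principal_left_ideal_eqP [s gE].
  have ggs : g * star g = g by rewrite {1}gE -mulrA star_idempotent.
  by rewrite -{1}ggs starM starK ggs.
move=> a; have [e [n [ee n1 abs bse]]] := H a.
have [s bE] := principal_left_ideal_eqP (etrans abs bse).
have [r eE] := principal_left_ideal_eqP (esym (etrans abs bse)).
have bab : a ^+ n = a ^+ n * r * a ^+ n.
  by rewrite -mulrA -eE {2}bE -mulrA -expr2 ee.
have [p [[pp sp] cp rb br bp]] := regular_corner sa bab.
pose b := a ^+ n; pose q := 1 - p.
have pq : p * q = 0 by rewrite mulrBr mulr1 -expr2 pp subrr.
have qp : q * p = 0 by rewrite mulrBl mul1r -expr2 pp subrr.
have qq : q * q = q by rewrite {2}/q mulrBr mulr1 qp subr0.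
have pq1 : p + q = 1 by rewrite addrC subrK.
have bq : b * q = 0 by rewrite /b -bp -mulrA pq mulr0.
have qb : q * b = 0 by rewrite /b -bp -cp mulrA qp mul0r.
have prq : p * r * q = 0 by rewrite (cp r) -mulrA pq mulr0.
have qpr : q * (p * r) = 0 by rewrite mulrA qp mul0r.
have comm_ab : GRing.comm a b by exact/commrX/commr_refl.
have comm_aq : GRing.comm a q.
  by apply: commrB; [exact: commr1|exact/commr_sym].
clearbody q.
(* In the corner cut out by [p], the inverse of [b] is [p * r]; adding the identity [q] of the
   complementary corner to both gives mutually inverse elements of the whole ring. *)
exists n, p, (b + q); split=> //.
- exists (p * r + q); split.
    by rewrite mulrDl !mulrDr prq qb qq -mulrA rb -expr2 pp addr0 add0r pq1.
  by rewrite mulrDl !mulrDr qpr bq qq mulrA bp br addr0 add0r pq1.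
- by rewrite mulrDr pq addr0 cp.
- split; first exact/commr_sym.
    exact: commrD.
  exact: cp.
Qed.

End StarIdempotents.

Theorem theorem2p5 (R : starRingType) :
  [<-> rad_star_abelian R; nil_star_abelian R;
       rad_star_normal R; nil_star_normal R] /\
  [<-> strongly_pi_star_regular R;
       pi_regular R /\
       [\/ rad_star_abelian R, nil_star_abelian R,
           rad_star_normal R | nil_star_normal R];
       star_abelian R /\
       (forall a : R, exists2 m : nat, (1 <= m)%N &
          principal_left_ideal (a ^+ m) =
          principal_left_ideal (a ^+ m * star (a ^+ m) * a ^+ m));
       (forall a : R, exists (e : R) (n : nat),
          [/\ idempotent_elt e, (1 <= n)%N,
              principal_left_ideal (a ^+ n) =
              principal_left_ideal (star (a ^+ n)) &
              principal_left_ideal (star (a ^+ n)) = principal_left_ideal e])].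
Proof.
(* Each disjunct in (2) amounts to the self-adjointness of idempotents, the form in which the cycle
   of implications uses (2). *)
have idem2 : pi_regular R /\
    [\/ rad_star_abelian R, nil_star_abelian R,
        rad_star_normal R | nil_star_normal R] <->
    pi_regular R /\ idempotents_self_adjoint R.
  split=> -[reg sa]; split=> //.
    case: sa; [move/rad_star_abelian_self_adjoint|
      move/nil_star_abelian_self_adjoint|move/rad_star_normal_self_adjoint|
      move/nil_star_normal_self_adjoint]; exact.
  exact/Or41/rad_star_abelian_self_adjoint.
split; tfae.
- by move/rad_star_abelian_self_adjoint/nil_star_abelian_self_adjoint.
- by move/nil_star_abelian_self_adjoint/rad_star_normal_self_adjoint.
- by move/rad_star_normal_self_adjoint/nil_star_normal_self_adjoint.
- by move/nil_star_normal_self_adjoint/rad_star_abelian_self_adjoint.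
- move=> str; apply/idem2; split.
    exact: strongly_pi_star_regular_pi_regular.
  exact: strongly_pi_star_regular_self_adjoint.
- move=> /idem2[reg sa]; split; first exact: self_adjoint_star_abelian.
  exact: pi_regular_star_cube.
- by case=> ab cube a; exact: star_cube_principal.
- exact: principal_strongly_pi_star_regular.
Qed.
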